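(* Every MV-algebra $A$ is isomorphic to a subalgebra of an MV-algebra with retractive radical.
   Context: For an MV-algebra $B$, $\operatorname{Rad}B$ is the intersection of all maximal ideals of $B$. $B$ has *retractive radical* if the natural projection $p:B\to B/\operatorname{Rad}B$ is a retraction, i.e. there is an MV-algebra embedding $j:B/\operatorname{Rad}B\to B$ such that $p\circ j=\mathrm{id}_{B/\operatorname{Rad}B}$. *)

(* Defs.v *)
From HB Require Import structures.
From mathcomp Require Import all_boot all_order all_algebra.
From mathcomp Require Import all_classical.

Set Implicit Arguments.
Unset Strict Implicit.
Unset Printing Implicit Defensive.

Import GRing.Theory.

Local Open Scope ring_scope.
Local Open Scope classical_set_scope.
Local Open Scope quotient_scope.

(* The commutative monoid (x (+) y, 0) of an MV-algebra is its nmodType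
   structure, so that x (+) y is written x + y.  Since 1 = neg 0, the axiom
   [mvaddr1] is x (+) 1 = 1.  The one-element algebra is allowed. *)
HB.mixin Record Nmodule_isMVAlgebra B of GRing.Nmodule B := {
  mvneg : B -> B;
  mvnegK : involutive mvneg;
  mvaddr1 : forall x : B, x + mvneg 0 = mvneg 0;
  mvjoinC : forall x y : B,
    mvneg (mvneg x + y) + y = mvneg (mvneg y + x) + x
}.

#[short(type="mvAlgType")]
HB.structure Definition MVAlgebra := {B of Nmodule_isMVAlgebra B & GRing.Nmodule B}.

Definition mvone {B : mvAlgType} : B := mvneg 0.

Definition mvle (B : mvAlgType) (x y : B) : Prop := mvneg x + y = mvone.

(* x (-) y = x (.) neg y *)
Definition mvsub (B : mvAlgType) (x y : B) : B := mvneg (mvneg x + y).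

(* Chang's distance *)
Definition mvdist (B : mvAlgType) (x y : B) : B := mvsub x y + mvsub y x.

Definition mv_morphism (A B : mvAlgType) (f : A -> B) : Prop :=
  [/\ f 0 = 0, {morph f : x y / x + y} & {morph f : x / mvneg x}].

Definition mv_embedding (A B : mvAlgType) (f : A -> B) : Prop :=
  mv_morphism f /\ injective f.

Definition mv_subalgebra (B : mvAlgType) (S : set B) : Prop :=
  [/\ S 0, forall x y, S x -> S y -> S (x + y) & forall x, S x -> S (mvneg x)].

Definition mv_isomorphic_to_subalgebra (A B : mvAlgType) : Prop :=
  exists S : set B, mv_subalgebra S /\
    exists f : A -> B, mv_morphism f /\ set_bij [set: A] S f.

Definition mv_ideal (B : mvAlgType) (I : set B) : Prop :=
  [/\ I 0, forall x y, I x -> I y -> I (x + y)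
    & forall x y, mvle x y -> I y -> I x].

Definition mv_maximal_ideal (B : mvAlgType) (M : set B) : Prop :=
  [/\ mv_ideal M, M <> [set: B]
    & forall J : set B, mv_ideal J -> M `<=` J -> J <> [set: B] -> J = M].

Record mvIdeal (B : mvAlgType) := MVIdeal {
  mvideal_set :> B -> Prop;
  mvidealP : mv_ideal mvideal_set
}.

(* The empty intersection, which occurs only for the one-element algebra, is
   the whole algebra. *)
Definition Rad_set (B : mvAlgType) : set B :=
  \bigcap_(M in [set M : set B | mv_maximal_ideal M]) M.

Lemma Rad_set_ideal (B : mvAlgType) : mv_ideal (@Rad_set B).
Proof.
split=> [M [[]] //|x y Rx Ry M maxM|x y lexy Ry M maxM].
  by case: (maxM) => -[_ addM _] _ _; apply: addM; [apply: Rx|apply: Ry].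
by case: (maxM) => -[_ _ leM] _ _; apply: leM lexy _; apply: Ry.
Qed.

Definition Rad (B : mvAlgType) : mvIdeal B := MVIdeal (Rad_set_ideal B).

Section MVTheory.
Variable B : mvAlgType.
Implicit Types x y z : B.

Lemma mvneg1 : mvneg mvone = 0 :> B. Proof. exact: mvnegK. Qed.

Lemma mvaddx1 x : x + mvone = mvone. Proof. exact: mvaddr1. Qed.

Lemma mvadd1x x : mvone + x = mvone. Proof. by rewrite addrC mvaddx1. Qed.

Lemma mvaddNx x : mvneg x + x = mvone.
Proof. by have := mvjoinC x mvone; rewrite mvaddx1 mvneg1 add0r. Qed.

Lemma mvsub_addK x y : mvsub x y + y = mvsub y x + x.
Proof. exact: mvjoinC. Qed.

Lemma mvle_addr x y : mvle x (x + y).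
Proof. by rewrite /mvle addrA mvaddNx mvadd1x. Qed.

Lemma mvle_sub_triangle x y z : mvle (mvsub x z) (mvsub x y + mvsub y z).
Proof.
rewrite /mvle mvnegK -addrA (addrCA z) (addrC z) mvsub_addK.
rewrite (addrCA _ _ y) mvsub_addK addrCA (addrCA (mvneg x)).
by rewrite mvaddNx !mvaddx1.
Qed.

Lemma mvle_sub_add x y a b :
  mvle (mvsub (x + a) (y + b)) (mvsub x y + mvsub a b).
Proof.
rewrite /mvle mvnegK -addrA addrACA (addrC y) (addrC b).
rewrite (mvsub_addK x y) (mvsub_addK a b) (addrACA _ x) addrCA.
by rewrite mvaddNx mvaddx1.
Qed.

Lemma mvdistxx x : mvdist x x = 0.
Proof. by rewrite /mvdist /mvsub mvaddNx mvneg1 addr0. Qed.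

Lemma mvdistC x y : mvdist x y = mvdist y x.
Proof. exact: addrC. Qed.

Lemma mvdistN x y : mvdist (mvneg x) (mvneg y) = mvdist x y.
Proof. by rewrite /mvdist /mvsub !mvnegK addrC (addrC x) (addrC y). Qed.

Variable I : mvIdeal B.

Lemma mvideal0 : I 0. Proof. by case: (mvidealP I). Qed.

Lemma mvidealD x y : I x -> I y -> I (x + y).
Proof. by case: (mvidealP I) => _ + _; apply. Qed.

Lemma mvideal_le x y : mvle x y -> I y -> I x.
Proof. by case: (mvidealP I) => _ _; apply. Qed.

Lemma mvideal_dist x y : I (mvdist x y) <-> I (mvsub x y) /\ I (mvsub y x).
Proof.
split=> [Ixy|[Ixy Iyx]]; last exact: mvidealD.
split; apply: mvideal_le Ixy; first exact: mvle_addr.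
by rewrite /mvdist addrC; exact: mvle_addr.
Qed.

Lemma mvideal_dist_trans x y z :
  I (mvdist x y) -> I (mvdist y z) -> I (mvdist x z).
Proof.
move=> /mvideal_dist[Ixy Iyx] /mvideal_dist[Iyz Izy]; apply/mvideal_dist.
by split; apply: mvideal_le (mvle_sub_triangle _ y _) _; apply: mvidealD.
Qed.

Lemma mvideal_distD x y a b :
  I (mvdist x y) -> I (mvdist a b) -> I (mvdist (x + a) (y + b)).
Proof.
move=> /mvideal_dist[Ixy Iyx] /mvideal_dist[Iab Iba]; apply/mvideal_dist.
by split; apply: mvideal_le (mvle_sub_add _ _ _ _) _; apply: mvidealD.
Qed.

Definition mvequiv : rel B := fun x y => `[< I (mvdist x y) >].

Lemma mvequiv_is_equiv : equiv_class_of mvequiv.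
Proof.
split=> [x|x y|y x z].
- by apply/asboolP; rewrite mvdistxx; exact: mvideal0.
- by rewrite /mvequiv mvdistC.
- by move=> /asboolP Ixy /asboolP Iyz; apply/asboolP;
    exact: mvideal_dist_trans Ixy Iyz.
Qed.

Canonical mvequiv_equiv := EquivRelPack mvequiv_is_equiv.

Definition mvquot := {eq_quot mvequiv}.

HB.instance Definition _ := Choice.on mvquot.
HB.instance Definition _ := EqQuotient.on mvquot.

Definition mvquot_zero : mvquot := \pi_mvquot 0.
Definition mvquot_add (u v : mvquot) : mvquot := \pi_mvquot (repr u + repr v).
Definition mvquot_neg (u : mvquot) : mvquot := \pi_mvquot (mvneg (repr u)).

Lemma mvquotW (P : mvquot -> Prop) :
  (forall x, P (\pi_mvquot x)) -> forall u, P u.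
Proof. by move=> piP u; rewrite -[u]reprK. Qed.

Lemma mvquot_eqP x y : \pi_mvquot x = \pi_mvquot y <-> I (mvdist x y).
Proof. by split=> [/eqquotP/asboolP|Ixy] //; apply/eqquotP/asboolP. Qed.

Lemma mvquot_piD x y :
  \pi_mvquot (x + y) = mvquot_add (\pi_mvquot x) (\pi_mvquot y).
Proof. by apply/mvquot_eqP/mvideal_distD; apply/mvquot_eqP; rewrite reprK. Qed.

Lemma mvquot_piN x : \pi_mvquot (mvneg x) = mvquot_neg (\pi_mvquot x).
Proof. by apply/mvquot_eqP; rewrite mvdistN; apply/mvquot_eqP; rewrite reprK. Qed.

Lemma mvquot_addA : associative mvquot_add.
Proof.
move=> u v w; elim/mvquotW: u => x; elim/mvquotW: v => y; elim/mvquotW: w => z.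
by rewrite -!mvquot_piD addrA.
Qed.

Lemma mvquot_addC : commutative mvquot_add.
Proof.
move=> u v; elim/mvquotW: u => x; elim/mvquotW: v => y.
by rewrite -!mvquot_piD addrC.
Qed.

Lemma mvquot_add0 : left_id mvquot_zero mvquot_add.
Proof.
by move=> u; elim/mvquotW: u => x; rewrite /mvquot_zero -mvquot_piD add0r.
Qed.

HB.instance Definition _ :=
  GRing.isNmodule.Build mvquot mvquot_addA mvquot_addC mvquot_add0.

Lemma mvquot_negK : involutive mvquot_neg.
Proof. by move=> u; elim/mvquotW: u => x; rewrite -!mvquot_piN mvnegK. Qed.

Lemma mvquot_addr1 (u : mvquot) :
  mvquot_add u (mvquot_neg mvquot_zero) = mvquot_neg mvquot_zero.
Proof.
elim/mvquotW: u => x.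
by rewrite /mvquot_zero -mvquot_piN -mvquot_piD mvaddr1.
Qed.

Lemma mvquot_joinC (u v : mvquot) :
  mvquot_add (mvquot_neg (mvquot_add (mvquot_neg u) v)) v =
  mvquot_add (mvquot_neg (mvquot_add (mvquot_neg v) u)) u.
Proof.
elim/mvquotW: u => x; elim/mvquotW: v => y.
by rewrite -!(mvquot_piN, mvquot_piD) mvjoinC.
Qed.

HB.instance Definition _ :=
  Nmodule_isMVAlgebra.Build mvquot mvquot_negK mvquot_addr1 mvquot_joinC.

Lemma mvquot_pi_morphism : mv_morphism (\pi_mvquot : B -> mvquot).
Proof. by split=> [//|x y|x]; rewrite ?mvquot_piD ?mvquot_piN. Qed.

End MVTheory.

Definition mv_retractive_radical (B : mvAlgType) : Prop :=
  exists j : mvquot (Rad B) -> B,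
    mv_embedding j /\ \pi_(mvquot (Rad B)) \o j = id.

(* Main.v *)
From HB Require Import structures.
From mathcomp Require Import all_boot all_order all_algebra.
From mathcomp Require Import all_classical.
From mathcomp Require Import zify.
Require Import Defs.

(* By Chang's subdirect representation, [A] embeds into the product of its
   quotients by prime ideals, which are chains, and a chain [C] is an interval
   [0, u] of a totally ordered abelian group [G], enlarged here to its divisible
   hull.  The elements of [G] infinitesimal with respect to [u] form a divisible
   convex subgroup, which therefore has a complement [V], and [V] can be chosen
   to contain [u].  The projection of [G] onto [V] preserves the order (by
   convexity) and [u], so it induces an endomorphism of the MV-algebra [0, u]
   that moves elements by infinitesimals only and kills the infinitesimals.
   These endomorphisms act on the product [B] of the algebras [0, u].
   Infinitesimals lie in every maximal ideal, and the kernel of each component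
   of the endomorphism is a maximal ideal because its image is archimedean; so
   the endomorphism kills [Rad B] and induces a section of [B -> B / Rad B]. *)

Set Implicit Arguments.
Unset Strict Implicit.
Unset Printing Implicit Defensive.

Import GRing.Theory.

Local Open Scope ring_scope.
Local Open Scope classical_set_scope.
Local Open Scope quotient_scope.

(** * Order and prime ideals of MV-algebras *)

(** Apply Zorn's lemma to the sets whose union with [X0] satisfies [P]: the empty chain is then
    covered by [P X0], and [P] itself need only be preserved by unions of nonempty chains. *)
Lemma Zorn_bigcup_above (T : Type) (P : set (set T)) (X0 : set T) :
    P X0 ->
    (forall F : set (set T), F `<=` P -> F !=set0 -> total_on F subset ->
      P (\bigcup_(X in F) X)) ->
  exists A, [/\ X0 `<=` A, P A & forall B, A `<=` B -> P B -> B = A].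
Proof.
move=> PX0 PF; have [F FP totF|A [PA maxA]] :=
  @Zorn_bigcup T [set X | P (X `|` X0)].
  rewrite /=; have [->|/set0P F0] := eqVneq F set0.
    by rewrite bigcup_set0 set0U.
  suff -> : \bigcup_(X in F) X `|` X0 =
      \bigcup_(Y in [set Z `|` X0 | Z in F]) Y.
    apply: PF => [_ [Y FY <-]||_ _ [Y FY <-] [Z FZ <-]]; first exact: FP.
      by case: F0 => Y FY; exists (Y `|` X0), Y.
    by have [YZ|ZY] := totF _ _ FY FZ; [left|right]; exact: setSU.
  by rewrite bigcup_image bigcupUl.
exists (A `|` X0); split=> // B AB PB.
have X0B : X0 `<=` B by move=> x X0x; apply: AB; right.
apply/seteqP; split=> // x Bx; left; apply: contrapT => nAx.
apply: (maxA B); last by rewrite /= setUidl.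
by split=> [y Ay|BA]; [apply: AB; left|exact/nAx/BA].
Qed.

Section MVOrder.
Variable A : mvAlgType.
Implicit Types x y z : A.

Definition mvmul x y := mvneg (mvneg x + mvneg y).

Lemma mvneg0 : mvneg 0 = mvone :> A. Proof. by []. Qed.

Lemma mvneg_inj : injective (@mvneg A). Proof. exact: inv_inj (@mvnegK A). Qed.

Lemma mvmulC x y : mvmul x y = mvmul y x.
Proof. by rewrite /mvmul addrC. Qed.

Lemma mvmulA x y z : mvmul x (mvmul y z) = mvmul (mvmul x y) z.
Proof. by rewrite /mvmul !mvnegK addrA. Qed.

Lemma mvle_refl x : mvle x x. Proof. exact: mvaddNx. Qed.

Lemma mvle0x x : mvle 0 x. Proof. by rewrite /mvle mvneg0 mvadd1x. Qed.

Lemma mvlex1 x : mvle x mvone. Proof. exact: mvaddx1. Qed.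

Lemma mvsub_eq0 x y : mvsub x y = 0 <-> mvle x y.
Proof.
by split=> [/(congr1 mvneg)|xy]; rewrite /mvsub ?mvnegK // xy mvneg1.
Qed.

Lemma mvlex0 x : mvle x 0 -> x = 0.
Proof. by rewrite /mvle addr0 => /(congr1 mvneg); rewrite mvnegK mvneg1. Qed.

Lemma mvle_sub_addK x y : mvle y x -> mvsub x y + y = x.
Proof. by move/mvsub_eq0 => yx; rewrite mvsub_addK yx add0r. Qed.

Lemma mvle_anti x y : mvle x y -> mvle y x -> x = y.
Proof.
move=> xy /mvle_sub_addK <-; rewrite (proj2 (mvsub_eq0 _ _) xy).
by rewrite add0r.
Qed.

Lemma mvle_trans y x z : mvle x y -> mvle y z -> mvle x z.
Proof.
move=> /mvsub_eq0 xy /mvsub_eq0 yz; apply/mvsub_eq0/mvlex0.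
by have := mvle_sub_triangle x y z; rewrite xy yz addr0.
Qed.

Lemma mvleD x y z t : mvle x y -> mvle z t -> mvle (x + z) (y + t).
Proof.
move=> /mvsub_eq0 xy /mvsub_eq0 zt; apply/mvsub_eq0/mvlex0.
by have := mvle_sub_add x y z t; rewrite xy zt addr0.
Qed.

Lemma mvle_addl x y : mvle x (y + x).
Proof. by rewrite addrC; exact: mvle_addr. Qed.

Lemma mvleN x y : mvle x y -> mvle (mvneg y) (mvneg x).
Proof. by rewrite /mvle mvnegK addrC. Qed.

Lemma mvsub_leP x y z : mvle (mvsub x y) z <-> mvle x (y + z).
Proof. by rewrite /mvle mvnegK addrA. Qed.

Lemma mvsub_le x y : mvle (mvsub x y) x.
Proof. by apply/mvsub_leP; exact: mvle_addl. Qed.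

Lemma mvsubE x y : mvsub x y = mvmul x (mvneg y).
Proof. by rewrite /mvmul mvnegK. Qed.

Lemma mvmul_le x y : mvle (mvmul x y) x.
Proof. by rewrite -[y]mvnegK -mvsubE; exact: mvsub_le. Qed.

Lemma mvdist_eq0 x y : mvdist x y = 0 -> x = y.
Proof.
move=> d0; apply: mvle_anti; apply/mvsub_eq0/mvlex0; rewrite -d0.
  exact: mvle_addr.
exact: mvle_addl.
Qed.

Lemma mvaddK x y : mvle x (mvneg y) -> mvsub (x + y) y = x.
Proof.
move=> /mvleN; rewrite mvnegK => /mvle_sub_addK yx.
by rewrite -[RHS]mvnegK -yx {2}/mvsub mvnegK addrC [y + x]addrC.
Qed.

(** Write [z] as [mvsub z y + y] and absorb this [y] into [mvsub x y]. *)
Lemma mvsub_add_exchange x y z :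
  mvle y x -> mvle y z -> mvsub x y + z = x + mvsub z y.
Proof.
move=> yx yz; rewrite -{1}(mvle_sub_addK yz) addrA addrAC.
by rewrite (mvle_sub_addK yx).
Qed.

Lemma mvadd_sub_assoc x y z :
  mvle y x -> mvle x (mvneg z) -> mvsub (x + z) y = mvsub x y + z.
Proof.
move=> yx xz; rewrite -{1}(mvle_sub_addK yx) addrAC mvaddK //.
have zx := mvleN xz; rewrite mvnegK in zx.
(* Cancelling [y] requires [mvsub x y + z <= mvneg y]. Since [z <= mvneg x <= mvneg y], the
   intermediate term equals [mvneg y]. *)
apply: (@mvle_trans (mvsub (mvneg y) z + z)).
  apply: mvleD (mvle_refl z); rewrite /mvsub; apply: mvleN.
  by rewrite mvnegK addrC; exact: mvleD zx (mvle_refl y).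
rewrite mvle_sub_addK; first exact: mvle_refl.
exact: mvle_trans zx (mvleN yx).
Qed.

Lemma mvle_sub2r z x y : mvle x y -> mvle (mvsub x z) (mvsub y z).
Proof.
move=> xy; apply/mvsub_leP; rewrite addrC mvsub_addK.
exact: mvle_trans xy (mvle_addl _ _).
Qed.

Lemma mvjoin_le x y z : mvle x z -> mvle y z -> mvle (mvsub x y + y) z.
Proof.
move=> xz yz; rewrite -(mvle_sub_addK yz).
exact: mvleD (mvle_sub2r _ xz) (mvle_refl y).
Qed.

Lemma mvsub_leN x y : mvle (mvsub x y) (mvneg y).
Proof. by apply: mvleN; exact: mvle_addl. Qed.

(* The join [m] of [x] and [y] satisfies [m <= m - z] and [m <= neg z]. *)
Lemma mvsub_disjoint x y z :
  mvle z (mvsub x y) -> mvle z (mvsub y x) -> z = 0.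
Proof.
move=> zxy zyx; pose m := mvsub x y + y.
have zNy : mvle z (mvneg y) := mvle_trans zxy (mvsub_leN x y).
have zNx : mvle z (mvneg x) := mvle_trans zyx (mvsub_leN y x).
have yNz : mvle y (mvneg z) by rewrite -[y]mvnegK; exact: mvleN.
have xNz : mvle x (mvneg z) by rewrite -[x]mvnegK; exact: mvleN.
have zm : mvle z m := mvle_trans zxy (mvle_addr _ _).
have mNz : mvle m (mvneg z) by exact: mvjoin_le.
have mmz : mvle m (mvsub m z).
  apply: mvjoin_le.
    rewrite -(mvaddK xNz); apply: mvle_sub2r; rewrite /m mvsub_addK addrC.
    exact: mvleD zyx (mvle_refl x).
  rewrite -(mvaddK yNz); apply: mvle_sub2r; rewrite addrC.
  exact: mvleD zxy (mvle_refl y).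
have zNm : mvle z (mvneg m) by rewrite -[z]mvnegK; exact: mvleN.
rewrite -(mvaddK zNm); apply/mvsub_eq0.
have := mvleD mmz (mvle_refl z); rewrite (mvle_sub_addK zm).
by rewrite addrC.
Qed.

(** Induction on [n]: from [z <= y + y *+ n] the element [mvsub z y] is below [y *+ n] and [x],
    hence is 0, so that [z <= y]. *)
Lemma mvdisjoint_muln x y n :
    (forall z, mvle z x -> mvle z y -> z = 0) ->
  forall z, mvle z x -> mvle z (y *+ n) -> z = 0.
Proof.
move=> xy; elim: n => [|n IHn] z zx; first by rewrite mulr0n => /mvlex0.
rewrite mulrS => /mvsub_leP zyn; apply: xy => //.
by apply/mvsub_eq0; apply: IHn zyn; exact: mvle_trans (mvsub_le _ _) zx.
Qed.

End MVOrder.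

(** * Generated ideals and prime ideals *)

Section MVIdeal.
Variable A : mvAlgType.
Implicit Types (I : set A) (x y : A).

Lemma mv_ideal_muln I x n : mv_ideal I -> I x -> I (x *+ n).
Proof.
move=> [I0 ID _] Ix; elim: n => [|n IHn]; first by rewrite mulr0n.
by rewrite mulrS; exact: ID.
Qed.

Definition mv_adjoin I x : set A :=
  [set y | exists i n, I i /\ mvle y (i + x *+ n)].

Lemma mv_adjoin_ideal I x : mv_ideal I -> mv_ideal (mv_adjoin I x).
Proof.
move=> [I0 ID _]; split=> [|y z [i [m [Ii yi]]] [j [n [Ij zj]]]|y z yz].
- by exists 0, 0%N; split=> //; exact: mvle0x.
- exists (i + j), (m + n)%N; split; first exact: ID.
  by rewrite mulrnDr addrACA; exact: mvleD.
- move=> [i [n [Ii zi]]]; exists i, n; split=> //; exact: mvle_trans yz zi.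
Qed.

Lemma mv_adjoin_sub I x : I `<=` mv_adjoin I x.
Proof.
move=> y Iy; exists y, 0%N; rewrite mulr0n addr0; split=> //.
exact: mvle_refl.
Qed.

Lemma mv_adjoin_mem I x : mv_ideal I -> mv_adjoin I x x.
Proof.
move=> [I0 _ _]; exists 0, 1%N; rewrite mulr1n add0r; split=> //.
exact: mvle_refl.
Qed.

Lemma mv_ideal_bigcup (F : set (set A)) :
    F !=set0 -> total_on F subset -> (forall I, F I -> mv_ideal I) ->
  mv_ideal (\bigcup_(I in F) I).
Proof.
move=> [I0 FI0] totF idF; split.
- by exists I0 => //; case: (idF _ FI0).
- move=> x y [I FI Ix] [J FJ Jy]; have [IJ|JI] := totF _ _ FI FJ.
    by exists J => //; case: (idF _ FJ) => _ + _; apply=> //; exact: IJ.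
  by exists I => //; case: (idF _ FI) => _ + _; apply=> //; exact: JI.
- move=> x y xy [I FI Iy]; exists I => //.
  by case: (idF _ FI) => _ _; apply; eassumption.
Qed.

Definition mv_prime_ideal I : Prop :=
  [/\ mv_ideal I, ~ I mvone & forall x y, I (mvsub x y) \/ I (mvsub y x)].

(** Take [I] maximal among the ideals that avoid [x]. If both [mvsub y z] and [mvsub z y] were
    outside [I], adjoining either one would capture [x]. *)
Lemma mv_prime_ideal_avoiding x :
  x <> 0 -> exists I, mv_prime_ideal I /\ ~ I x.
Proof.
move=> x0; have [||I [_ [idI nIx] maxI]] :=
  @Zorn_bigcup_above A [set I | mv_ideal I /\ ~ I x] [set 0].
- split=> [|//]; split=> //= y z; first by move=> -> ->; rewrite addr0.
  by move=> + z0; rewrite z0; exact: mvlex0.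
- move=> F FP F0 totF; split; first by apply: mv_ideal_bigcup => // I /FP[].
  by move=> [I /FP[_]].
have adjI y : ~ I y -> mv_adjoin I y x.
  move=> nIy; apply: contrapT => nx; apply: nIy.
  rewrite -(maxI (mv_adjoin I y)); [exact: mv_adjoin_mem|exact: mv_adjoin_sub|].
  by split=> //; exact: mv_adjoin_ideal.
have [_ ID Ile] := idI.
exists I; split=> //; split=> //.
  by move=> I1; apply: nIx; apply: Ile I1; exact: mvlex1.
move=> y z; apply: contrapT.
move=> /not_orP[/adjI[i [m [Ii xi]]] /adjI[j [n [Ij xj]]]].
apply: nIx; apply: Ile (ID _ _ Ii Ij); apply/mvsub_eq0.
(* Removing [i + j] from [x] leaves an element below a multiple of [mvsub y z] and a multiple of
   [mvsub z y]. These two differences are disjoint, and so are their multiples, by one extension on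
   each side. *)
apply: (@mvdisjoint_muln _ (mvsub y z *+ m) (mvsub z y) n).
- move=> t tm tz.
  apply: (@mvdisjoint_muln _ (mvsub z y) (mvsub y z) m) => // w wz wy.
  exact: mvsub_disjoint wz wy.
- apply/mvsub_leP; apply: mvle_trans xi _; rewrite -addrA (addrC j).
  by rewrite addrA; exact: mvle_addr.
- apply/mvsub_leP; apply: mvle_trans xj _; rewrite -addrA; exact: mvle_addl.
Qed.

End MVIdeal.

Lemma mvquot_prime_total (A : mvAlgType) (I : mvIdeal A) (u v : mvquot I) :
  mv_prime_ideal I -> mvle u v \/ mvle v u.
Proof.
move=> [_ _ prI]; have [_ piD piN] := mvquot_pi_morphism I.
elim/mvquotW: u => x; elim/mvquotW: v => y.
suff le_pi z t : I (mvsub z t) -> mvle (\pi_(mvquot I) z) (\pi t).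
  by have [/le_pi|/le_pi] := prI x y; [left|right].
move=> Izt; apply/mvsub_eq0; rewrite /mvsub -piN -piD -piN.
apply/mvquot_eqP; rewrite /mvdist /mvsub mvnegK !addr0; apply: mvidealD => //.
by rewrite mvneg0 mvadd1x mvneg1; exact: mvideal0.
Qed.

(** * Totally ordered groups and Chang's group of a chain *)

(* The order is given by the cone [nneg] of its nonnegative elements. *)
HB.mixin Record Zmodule_isTotallyOrdered G of GRing.Zmodule G := {
  nneg : G -> Prop;
  nnegD : forall x y : G, nneg x -> nneg y -> nneg (x + y);
  nneg_anti : forall x : G, nneg x -> nneg (- x) -> x = 0;
  nneg_total : forall x : G, nneg x \/ nneg (- x)
}.

#[short(type="oZmodType")]
HB.structure Definition OrderedZmodule :=
  {G of Zmodule_isTotallyOrdered G & GRing.Zmodule G}.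

Section OrderedGroup.
Variable G : oZmodType.
Implicit Types x y z : G.

Lemma nneg0 : nneg (0 : G).
Proof. by have [//|] := nneg_total (0 : G); rewrite oppr0. Qed.

Lemma nnegMn x n : nneg x -> nneg (x *+ n).
Proof.
move=> x0; elim: n => [|n IHn]; first by rewrite mulr0n; exact: nneg0.
by rewrite mulrS; exact: nnegD.
Qed.

(** For nonnegative [x], the equation makes [- x = x *+ n] nonnegative too; so the group is
    torsion-free. *)
Lemma nneg_mulrn_eq0 x n : x *+ n.+1 = 0 -> x = 0.
Proof.
wlog x0 : x / nneg x => [IH|].
  have [/IH//|/IH Nx] := nneg_total x.
  by move=> xn0; apply: oppr_inj; rewrite oppr0 Nx // mulNrn xn0 oppr0.
move=> xn0; apply: nneg_anti => //.
suff -> : - x = x *+ n by exact: nnegMn.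
by apply/eqP; rewrite eq_sym -addr_eq0 addrC -mulrS xn0.
Qed.

Lemma mulrSn_inj n : injective (fun x : G => x *+ n.+1).
Proof.
move=> x y /= xy; apply/eqP; rewrite -subr_eq0; apply/eqP.
by apply: (@nneg_mulrn_eq0 _ n); rewrite mulrnBl xy subrr.
Qed.

Lemma nneg_mulrSn x n : nneg (x *+ n.+1) -> nneg x.
Proof.
have [//|Nx] := nneg_total x => xn.
rewrite (@nneg_mulrn_eq0 x n); first exact: nneg0.
by apply: nneg_anti => //; rewrite -mulNrn; exact: nnegMn.
Qed.

Lemma nneg_subr_total x y : nneg (y - x) \/ nneg (x - y).
Proof. by rewrite -opprB; case: (nneg_total (x - y)); [right|left]. Qed.

End OrderedGroup.

(** * Chang's group of a nontrivial chain *)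

Section ChangGroup.
Variable C : mvAlgType.
Hypothesis C_total : forall x y : C, mvle x y \/ mvle y x.
Hypothesis C_nontrivial : mvone != 0 :> C.
Implicit Types a b c : C.

(** In the group to be built, [a + b] is [chang_carry a b] units plus [chang_digit a b]: once the
    truncated sum reaches 1, the excess over the unit is the MV-product. *)
Definition chang_carry a b : bool := a + b == mvone.
Definition chang_digit a b : C :=
  if chang_carry a b then mvmul a b else a + b.

Lemma chang_carryF a b : ~~ chang_carry a b -> mvle a (mvneg b).
Proof.
move=> /eqP ab1; have [|//] := C_total (mvneg b) a.
by rewrite /mvle mvnegK addrC.
Qed.

Lemma chang_carryT a b : chang_carry a b -> mvle (mvneg a) b.
Proof. by move/eqP; rewrite /mvle mvnegK. Qed.

Lemma chang_carryC a b : chang_carry a b = chang_carry b a.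
Proof. by rewrite /chang_carry addrC. Qed.

Lemma chang_digitC a b : chang_digit a b = chang_digit b a.
Proof. by rewrite /chang_digit chang_carryC mvmulC addrC. Qed.

(** The product [mvmul a b] is [b] minus [mvneg a], and adding [c <= mvneg b] commutes with this
    subtraction. A carry with [c] would give [mvneg c <= mvmul a b <= b <= mvneg c], so [b] and [c]
    would already carry. *)
Lemma chang_carry_mixed a b c :
    chang_carry a b -> ~~ chang_carry b c ->
  mvmul a b + c = mvmul a (b + c) /\ ~~ chang_carry (mvmul a b) c.
Proof.
move=> ab bc; have Nab := chang_carryT ab; have bNc := chang_carryF bc; split.
  rewrite mvmulC (mvmulC a) -[a]mvnegK -!mvsubE.
  by rewrite mvadd_sub_assoc.
apply: contra bc => /chang_carryT Nabc.
have cab : mvle (mvneg c) (mvmul a b).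
  by rewrite -[mvmul a b]mvnegK; exact: mvleN.
have cb : mvle (mvneg c) b.
  by apply: mvle_trans cab _; rewrite mvmulC; exact: mvmul_le.
by rewrite (mvle_anti bNc cb) /chang_carry mvaddNx.
Qed.

(** This is associativity of the group addition: the digits associate, and the carries that
    accumulate in the integer part satisfy the cocycle identity. *)
Lemma chang_digit_carry_assoc a b c :
  chang_digit (chang_digit a b) c = chang_digit a (chang_digit b c) /\
  (chang_carry a b + chang_carry (chang_digit a b) c =
   chang_carry b c + chang_carry a (chang_digit b c))%N.
Proof.
(* Exchanging [a] and [c] swaps the two sides, so the case where [b, c] carry but [a, b] do not can
   be left out. *)
wlog le_bc_ab : a b c / chang_carry b c ==> chang_carry a b => [IH|].
  have [/IH//|] := boolP (chang_carry b c ==> chang_carry a b).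
  rewrite negb_imply => /andP[bc nab].
  have [|dE kE] := IH c b a.
    by rewrite chang_carryC (negbTE nab).
  move: dE kE; rewrite ![chang_digit c _]chang_digitC.
  rewrite ![chang_digit _ a]chang_digitC ![chang_carry c _]chang_carryC.
  rewrite ![chang_carry _ a]chang_carryC => <- kE.
  split=> //; lia.
have [ab|nab] := boolP (chang_carry a b);
  have [bc|nbc] := boolP (chang_carry b c).
- rewrite /chang_digit ab bc.
  have E : mvmul a b + c = a + mvmul b c.
    rewrite -{1}[b]mvnegK -mvsubE mvsub_add_exchange.
    - by rewrite mvsubE mvnegK mvmulC.
    - by apply: chang_carryT; rewrite chang_carryC.
    - exact: chang_carryT.
  by rewrite /chang_carry E mvmulA.
- have [E nk] := chang_carry_mixed ab nbc.
  have -> : chang_digit a b = mvmul a b by rewrite /chang_digit ab.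
  have -> : chang_digit b c = b + c by rewrite /chang_digit (negbTE nbc).
  have abc : chang_carry a (b + c).
    by rewrite /chang_carry addrA (eqP ab) mvadd1x.
  by rewrite /chang_digit (negbTE nk) abc.
- by move: le_bc_ab; rewrite bc (negbTE nab).
- rewrite /chang_digit (negbTE nab) (negbTE nbc) /chang_carry addrA.
  (* If the total carries, negation turns the equality of the two products into the exchange law for
     [mvneg a], [b], [mvneg c]. *)
  case: ifP => // _; split=> //; apply: mvneg_inj.
  rewrite /mvmul !mvnegK.
  have := @mvsub_add_exchange _ (mvneg a) b (mvneg c).
  rewrite /mvsub !mvnegK addrC [c + b]addrC; apply; last exact: chang_carryF.
  by apply: chang_carryF; rewrite chang_carryC.
Qed.

Lemma chang_digit_neq1 a b :
  a != mvone -> b != mvone -> chang_digit a b != mvone.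
Proof.
rewrite /chang_digit; case: ifP => [_ a1 _|/negbT//].
apply: contra a1 => /eqP ab; apply/eqP/mvle_anti; first exact: mvlex1.
by rewrite -ab; exact: mvmul_le.
Qed.

(* The pair [(n, a)] stands for [n u + a] with [u] the unit; the value [a = 1]
   is excluded because [n u + 1] is [(n + 1) u + 0].  The hypotheses are
   arguments of the type so that its group structure can be inferred; likewise
   for [gamma_algebra] below. *)
Definition chang_group of (forall x y : C, mvle x y \/ mvle y x)
  & (mvone != 0 :> C) : Type := (int * {a : C | a != mvone})%type.

Local Notation chang := (chang_group C_total C_nontrivial).

HB.instance Definition _ := Choice.on chang.

Implicit Types x y z : chang.

Lemma chang_neq1 x : sval x.2 != mvone. Proof. exact: (proj2_sig x.2). Qed.

Lemma chang_eq x y : x.1 = y.1 -> sval x.2 = sval y.2 -> x = y.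
Proof. by case: x y => [n a] [m b] /= -> /val_inj ->. Qed.

Definition chang_pair (n : int) a (a1 : a != mvone) : chang :=
  (n, exist (fun a => is_true (a != mvone)) a a1).

Lemma mv0_neq1 : 0 != mvone :> C. Proof. by rewrite eq_sym. Qed.

Definition chang_zero : chang := chang_pair 0 mv0_neq1.

Definition chang_add x y : chang :=
  chang_pair (x.1 + y.1 + (chang_carry (sval x.2) (sval y.2))%:Z)
    (chang_digit_neq1 (chang_neq1 x) (chang_neq1 y)).

Lemma mvneg_neq1 a : a != 0 -> mvneg a != mvone.
Proof. by apply: contra => /eqP/mvneg_inj->. Qed.

(** For a nonzero digit, [- (n u + a) = (- n - 1) u + (u - a)]; for [a = 0] this would produce the
    excluded digit 1. *)
Definition chang_opp x : chang :=
  if eqVneq (sval x.2) 0 is NeqNotEq x0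
  then chang_pair (- x.1 - 1) (mvneg_neq1 x0) else (- x.1, x.2).

Lemma chang_addC : commutative chang_add.
Proof.
move=> x y; apply: chang_eq => /=; last exact: chang_digitC.
by rewrite chang_carryC (addrC x.1).
Qed.

Lemma chang_addA : associative chang_add.
Proof.
move=> x y z; apply: chang_eq => /=.
all: have [dE kE] := chang_digit_carry_assoc (sval x.2) (sval y.2) (sval z.2).
  by move: kE; lia.
by rewrite dE.
Qed.

Lemma chang_add0 : left_id chang_zero chang_add.
Proof.
move=> x; apply: chang_eq => /=; rewrite /chang_digit /chang_carry !add0r.
  by rewrite (negbTE (chang_neq1 x)) addr0.
by rewrite (negbTE (chang_neq1 x)).
Qed.

Lemma chang_addN : left_inverse chang_zero chang_opp chang_add.
Proof.
move=> x; apply: chang_eq; rewrite /chang_opp /=; case: eqVneq => /= x0.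
- by rewrite x0 /chang_carry addr0 (negbTE mv0_neq1) addr0 addNr.
- by rewrite /chang_carry mvaddNx eqxx; lia.
- by rewrite x0 /chang_digit /chang_carry addr0 (negbTE mv0_neq1).
- by rewrite /chang_digit /chang_carry mvaddNx eqxx /mvmul mvaddNx mvneg1.
Qed.

HB.instance Definition _ :=
  GRing.isZmodule.Build chang chang_addA chang_addC chang_add0 chang_addN.

Definition chang_nneg x : Prop := 0 <= x.1.

Lemma chang_nnegD x y : chang_nneg x -> chang_nneg y -> chang_nneg (x + y).
Proof. by rewrite /chang_nneg -[x + y]/(chang_add x y) /=; lia. Qed.

Lemma chang_nneg_anti x : chang_nneg x -> chang_nneg (- x) -> x = 0.
Proof.
rewrite /chang_nneg -[- x]/(chang_opp x) /chang_opp.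
case: eqVneq => /= x0 le0x leN; last by lia.
by apply: chang_eq => //=; lia.
Qed.

Lemma chang_nneg_total x : chang_nneg x \/ chang_nneg (- x).
Proof.
rewrite /chang_nneg -[- x]/(chang_opp x) /chang_opp.
by case: eqVneq => /= x0; lia.
Qed.

HB.instance Definition _ := Zmodule_isTotallyOrdered.Build chang
  chang_nnegD chang_nneg_anti chang_nneg_total.

Definition chang_unit : chang := chang_pair 1 mv0_neq1.

Definition chang_inj a : chang :=
  if eqVneq a mvone is NeqNotEq a1 then chang_pair 0 a1 else chang_unit.

Lemma chang_inj_nneg a : nneg (chang_inj a).
Proof. by rewrite /chang_inj; case: eqVneq. Qed.

Lemma chang_inj0 : chang_inj 0 = 0.
Proof.
rewrite /chang_inj; case: eqVneq => [/eqP|a1].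
  by rewrite (negbTE mv0_neq1).
exact: chang_eq.
Qed.

Lemma chang_injN a : chang_inj (mvneg a) = chang_unit - chang_inj a.
Proof.
apply/eqP; rewrite eq_sym subr_eq; apply/eqP; rewrite /chang_inj.
case: (eqVneq a) => [->|a1]; case: eqVneq => [/eqP|Na1].
- by rewrite mvneg1 (negbTE mv0_neq1).
- apply: chang_eq; rewrite /= ?/chang_carry ?/chang_digit ?/chang_carry mvneg1;
  by rewrite addr0 (negbTE mv0_neq1).
- move=> /eqP/mvneg_inj a0; apply: chang_eq => /=.
    by rewrite /chang_carry a0 !addr0 (negbTE mv0_neq1).
  by rewrite /chang_digit /chang_carry a0 addr0 (negbTE mv0_neq1).
- apply: chang_eq; rewrite /= ?/chang_digit /chang_carry mvaddNx eqxx //.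
  by rewrite /mvmul mvnegK addrC mvaddNx mvneg1.
Qed.

(** The MV-sum becomes the group sum truncated at the unit. The two cases are kept apart so that
    they can be carried along [hull_inj]. *)
Lemma chang_injD a b :
  chang_inj (a + b) = chang_inj a + chang_inj b /\
    nneg (chang_unit - (chang_inj a + chang_inj b)) \/
  chang_inj (a + b) = chang_unit /\
    nneg (chang_inj a + chang_inj b - chang_unit).
Proof.
have [a1|a1] := eqVneq a mvone.
  right; rewrite a1 mvadd1x {1 2}/chang_inj; case: eqVneq => [_|/eqP//].
  by split=> //; rewrite addrAC subrr add0r; exact: chang_inj_nneg.
have [b1|b1] := eqVneq b mvone.
  right; rewrite b1 mvaddx1 {1 3}/chang_inj; case: eqVneq => [_|/eqP//].
  by split=> //; rewrite addrK; exact: chang_inj_nneg.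
have -> : chang_inj a = chang_pair 0 a1.
  rewrite /chang_inj; case: eqVneq => [/eqP|a1']; first by rewrite (negbTE a1).
  exact: chang_eq.
have -> : chang_inj b = chang_pair 0 b1.
  rewrite /chang_inj; case: eqVneq => [/eqP|b1']; first by rewrite (negbTE b1).
  exact: chang_eq.
rewrite /chang_inj; case: eqVneq => ab1.
  right; split=> //.
  rewrite /nneg /= /chang_nneg.
  rewrite -[X in 0 <= X.1]/(chang_add (chang_add _ _) (chang_opp _)).
  rewrite /chang_opp; case: eqVneq => /= [_|/eqP//].
  by rewrite /chang_carry ab1 eqxx; lia.
left; split.
  by apply: chang_eq; rewrite /= ?/chang_digit /chang_carry (negbTE ab1).
rewrite /nneg /= /chang_nneg.
rewrite -[X in 0 <= X.1]/(chang_add _ (chang_opp (chang_add _ _))).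
rewrite /chang_opp; case: eqVneq => /= _; rewrite /chang_carry (negbTE ab1);
  by lia.
Qed.

Lemma chang_inj_inj : injective chang_inj.
Proof.
move=> a b; rewrite /chang_inj.
by case: eqVneq => [->|a1]; case: eqVneq => [->|b1] // [].
Qed.

End ChangGroup.

(** * Splitting off the infinitesimals *)

Section Splitting.
Variables (G : oZmodType) (u : G).
Hypotheses (u_nneg : nneg u) (u_neq0 : u <> 0).
Hypothesis G_divisible : forall (x : G) n, exists y, y *+ n.+1 = x.
Implicit Types (x y v w : G) (V : set G).

(** The upper half of infinitesimality; the condition on [x] and on [- x] together replaces an
    absolute value. *)
Definition nbounded x := forall n, nneg (u - x *+ n).

Definition infinitesimal x := nbounded x /\ nbounded (- x).

(** Twice [u - n (x + y)] is [(u - 2n x) + (u - 2n y)], and halving preserves the sign. *)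
Lemma nboundedD x y : nbounded x -> nbounded y -> nbounded (x + y).
Proof.
move=> bx by_ n; apply: (@nneg_mulrSn _ _ 1%N).
have -> : (u - (x + y) *+ n) *+ 2 = (u - x *+ (n * 2)) + (u - y *+ (n * 2)).
  by rewrite addrACA -opprD -mulr2n -mulrnDl mulrnBl mulrnA.
exact: nnegD.
Qed.

Lemma nbounded_nneg x : nneg (- x) -> nbounded x.
Proof. by move=> Nx n; rewrite -mulNrn; apply: nnegD => //; exact: nnegMn. Qed.

Lemma nbounded_le x y : nneg y -> nbounded (x + y) -> nbounded x.
Proof.
move=> y0 bxy; rewrite -[x](addrK y); apply: nboundedD => //.
by apply: nbounded_nneg; rewrite opprK.
Qed.

Lemma nboundedMn x k : nbounded x -> nbounded (x *+ k).
Proof. by move=> bx n; rewrite -mulrnA; exact: bx. Qed.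

Lemma nbounded_mulrSn x k : nbounded (x *+ k.+1) -> nbounded x.
Proof.
move=> bx n; apply: (@nneg_mulrSn _ _ k).
rewrite mulrnBl mulrS addrAC -mulrnA mulnC mulrnA.
by apply: nnegD (bx n) _; exact: nnegMn.
Qed.

Lemma infinitesimal0 : infinitesimal 0.
Proof. by split; apply: nbounded_nneg; rewrite ?oppr0 //; exact: nneg0. Qed.

Lemma infinitesimalN x : infinitesimal x -> infinitesimal (- x).
Proof. by move=> [bx bNx]; split; rewrite ?opprK. Qed.

Lemma infinitesimalD x y :
  infinitesimal x -> infinitesimal y -> infinitesimal (x + y).
Proof.
by move=> [bx bNx] [b_y bNy]; split; rewrite ?opprD; exact: nboundedD.
Qed.

Lemma infinitesimal_mulrSn x k : infinitesimal (x *+ k.+1) -> infinitesimal x.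
Proof.
by move=> [bx bNx]; split; apply: (@nbounded_mulrSn _ k); rewrite ?mulNrn.
Qed.

Lemma infinitesimalMn x k : infinitesimal x -> infinitesimal (x *+ k).
Proof. by move=> [bx bNx]; split; rewrite -?mulNrn; exact: nboundedMn. Qed.

Lemma nneg_mulrz_unit (k : int) : nneg (u *~ k) -> 0 <= k.
Proof.
case: k => [//|n]; rewrite NegzE mulrNz => Nu.
case: u_neq0; apply: (@nneg_mulrn_eq0 _ _ n); apply: nneg_anti => //.
exact: nnegMn.
Qed.

Definition inf_free V : Prop :=
  [/\ V 0, forall x y, V x -> V y -> V (x - y)
    & forall x, V x -> infinitesimal x -> x = 0].

Lemma inf_freeN V x : inf_free V -> V x -> V (- x).
Proof. by move=> [V0 VB _] Vx; rewrite -sub0r; exact: VB. Qed.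

Lemma inf_freeD V x y : inf_free V -> V x -> V y -> V (x + y).
Proof.
move=> fV Vx Vy; rewrite -[y]opprK; case: (fV) => _ VB _; apply: VB => //.
exact: inf_freeN.
Qed.

Lemma inf_freeMn V x n : inf_free V -> V x -> V (x *+ n).
Proof.
move=> fV Vx; elim: n => [|n IHn]; first by case: fV.
by rewrite mulrS; exact: inf_freeD.
Qed.

(** Take [V] maximal among the subgroups that contain the multiples of [u] and meet the
    infinitesimals only in 0. An [x] outside [V] plus the infinitesimals could be adjoined to
    [V]. *)
Lemma inf_free_complement : exists V, [/\ inf_free V, V u
  & forall x, exists v, V v /\ infinitesimal (x - v)].
Proof.
have [||V [uV fV maxV]] :=
  @Zorn_bigcup_above G inf_free [set u *~ k | k in [set: int]].
- split; first by exists 0 => //; rewrite mulr0z.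
    by move=> _ _ [k _ <-] [l _ <-]; exists (k - l) => //; rewrite mulrzBr.
  (* For an infinitesimal [k u], the multiple 2 already gives [-1 <= 2k <= 1], so [k = 0]. *)
  move=> _ [k _ <-] [/(_ 2%N) bk /(_ 2%N) bNk].
  suff -> : k = 0 by rewrite mulr0z.
  have : 0 <= 1 - k *+ 2.
    by apply: nneg_mulrz_unit; rewrite mulr2n mulrzBr mulrzDr mulr1z -mulr2n.
  have : 0 <= 1 + k *+ 2.
    apply: nneg_mulrz_unit; rewrite mulr2n !mulrzDr mulr1z -mulr2n.
    by rewrite -[_ *+ 2]opprK -mulNrn.
  by lia.
- move=> F Ffree [V0 FV0] totF; split.
  + by exists V0 => //; case: (Ffree _ FV0).
  + move=> x y [V FV Vx] [W FW Wy]; have [VW|WV] := totF _ _ FV FW.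
      by exists W => //; case: (Ffree _ FW) => _ + _; apply=> //; exact: VW.
    by exists V => //; case: (Ffree _ FV) => _ + _; apply=> //; exact: WV.
  + by move=> x [V FV Vx]; case: (Ffree _ FV) => _ _; apply.
have [V0 VB VI] := fV.
have Vu : V u by apply: uV; exists 1 => //; rewrite mulr1z.
(* The elements with a positive multiple in [V] again form such a subgroup, so they lie in [V] by
   maximality. *)
have V_div x n : V (x *+ n.+1) -> V x.
  move=> Vx; rewrite -(maxV [set y | exists m, V (y *+ m.+1)]).
  - by exists n.
  - by move=> y Vy; exists 0%N.
  split.
  - by exists 0%N; rewrite mul0rn.
  - move=> y z [k Vy] [l Vz]; exists (k.+1 * l.+1).-1; rewrite prednK //.
    rewrite mulrnBl mulrnA mulnC mulrnA.
    by apply: VB; exact: inf_freeMn.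
  - move=> y [k Vy] iy; apply: (@nneg_mulrn_eq0 _ _ k).
    by apply: VI Vy _; exact: infinitesimalMn.
exists V; split=> // x; apply: contrapT => /forallNP nx.
(* Dividing [v] by [n + 1] inside [V] gives [w] with [w + x] infinitesimal, so [- w] would be a
   component of [x] in [V]. *)
have xfree v n : V v -> ~ infinitesimal (v + x *+ n.+1).
  have [w <-] := G_divisible v n => /V_div Vw.
  rewrite -mulrnDl addrC => /infinitesimal_mulrSn iwx.
  by apply: (nx (- w)); split; [exact: inf_freeN|rewrite opprK].
(* By [xfree] the subgroup generated by [V] and [x] still meets the infinitesimals only in 0;
   maximality puts [x] in [V], where it is its own component. *)
apply: (nx x); split; last by rewrite subrr; exact: infinitesimal0.
rewrite -(maxV [set v + x *~ k | v in V & k in [set: int]]).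
- by exists 0 => //; exists 1 => //; rewrite mulr1z add0r.
- by move=> v Vv; exists v => //; exists 0 => //; rewrite mulr0z addr0.
split.
- by exists 0 => //; exists 0 => //; rewrite mulr0z addr0.
- move=> _ _ [v Vv [k _ <-]] [w Vw [l _ <-]].
  exists (v - w); first exact: VB.
  by exists (k - l) => //; rewrite mulrzBr opprD addrACA.
move=> _ [v Vv [[[|n]|n] _ <-]].
- by rewrite mulr0z addr0; exact: VI.
- by move/xfree; case.
- move=> /infinitesimalN; rewrite NegzE mulrNz opprD opprK => /xfree; case.
  exact: inf_freeN.
Qed.

Lemma infinitesimal_retraction : exists rho : G -> G,
  [/\ {morph rho : x y / x + y}, rho u = u,
      forall x, nneg x -> nneg (rho x),
      forall x, infinitesimal (x - rho x)
    & forall x, infinitesimal x -> rho x = 0].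
Proof.
have [V [fV Vu compV]] := inf_free_complement; have [V0 VB VI] := fV.
have [rho rhoP] := choice compV.
have rhoE x v : V v -> infinitesimal (x - v) -> rho x = v.
  move=> Vv ixv; have [Vr ixr] := rhoP x.
  apply/eqP; rewrite -subr_eq0; apply/eqP/VI; first exact: VB.
  suff -> : rho x - v = (x - v) - (x - rho x).
    by apply: infinitesimalD => //; exact: infinitesimalN.
  by rewrite opprB [RHS]addrC addrA subrK.
exists rho; split.
- move=> x y; have [Vx ix] := rhoP x; have [Vy iy] := rhoP y.
  apply: rhoE; first exact: inf_freeD.
  by rewrite opprD addrACA; exact: infinitesimalD.
- by apply: rhoE => //; rewrite subrr; exact: infinitesimal0.
(* If [rho x <= 0 <= x], then [0 <= - rho x <= x - rho x], so [rho x] is an infinitesimal element of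
   [V], that is, 0. *)
- move=> x x0; have [//|Nrx] := nneg_total (rho x).
  have [Vr [bxr _]] := rhoP x.
  rewrite (VI _ Vr); first exact: nneg0.
  split; first exact: nbounded_nneg.
  by apply: (@nbounded_le _ x) => //; rewrite addrC.
- by move=> x; case: (rhoP x).
- by move=> x ix; apply: rhoE => //; rewrite subr0.
Qed.

End Splitting.

(** * The divisible hull *)

Section DivisibleHull.
Variable G : oZmodType.
Implicit Types (g h : G) (p q : G * nat).

(* The pair [(g, n)] stands for the fraction [g / (n + 1)]. *)
Definition hull_rel : rel (G * nat) :=
  fun p q => p.1 *+ q.2.+1 == q.1 *+ p.2.+1.

Lemma hull_rel_equiv : equiv_class_of hull_rel.
Proof.
split=> [p|p q|q p r]; rewrite /hull_rel; [exact: eqxx|exact: eq_sym|].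
move=> /eqP pq /eqP qr; apply/eqP; apply: (@mulrSn_inj _ q.2) => /=.
by rewrite -mulrnA mulnC mulrnA pq -mulrnA mulnC mulrnA qr -!mulrnA mulnC.
Qed.

Canonical hull_equiv := EquivRelPack hull_rel_equiv.

Definition hull := {eq_quot hull_rel}.

HB.instance Definition _ := Choice.on hull.
HB.instance Definition _ := EqQuotient.on hull.

Definition hfrac g n : hull := \pi_hull (g, n).

Lemma hfrac_eq g m h n : hfrac g m = hfrac h n <-> g *+ n.+1 = h *+ m.+1.
Proof. by split=> [/eqquotP/eqP|gh] //; apply/eqquotP/eqP. Qed.

Lemma hfracW (P : hull -> Prop) : (forall g n, P (hfrac g n)) -> forall x, P x.
Proof. by move=> Pf x; rewrite -[x]reprK; case: (repr x) => g n; exact: Pf. Qed.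

Lemma hfrac_mul g n k : hfrac (g *+ k.+1) (n.+1 * k.+1).-1 = hfrac g n.
Proof. by apply/hfrac_eq; rewrite prednK // -mulrnA mulnC. Qed.

(** Two fractions have a common denominator, so statements about the hull reduce to their
    numerators. *)
Lemma hfracW2 (P : hull -> hull -> Prop) :
  (forall g h n, P (hfrac g n) (hfrac h n)) -> forall x y, P x y.
Proof.
move=> Pf x y; elim/hfracW: x => g m; elim/hfracW: y => h n.
by rewrite -(hfrac_mul g m n) -(hfrac_mul h n m) mulnC; exact: Pf.
Qed.

Lemma hfracW3 (P : hull -> hull -> hull -> Prop) :
    (forall g h k n, P (hfrac g n) (hfrac h n) (hfrac k n)) ->
  forall x y z, P x y z.
Proof.
move=> Pf x y; move: x y; apply: hfracW2 => g h m; apply: hfracW => k n.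
rewrite -(hfrac_mul g m n) -(hfrac_mul h m n) -(hfrac_mul k n m) mulnC.
exact: Pf.
Qed.

Definition hull_add (x y : hull) : hull :=
  hfrac ((repr x).1 *+ (repr y).2.+1 + (repr y).1 *+ (repr x).2.+1)
        ((repr x).2.+1 * (repr y).2.+1).-1.

Definition hull_opp (x : hull) : hull := hfrac (- (repr x).1) (repr x).2.

Definition hull_nneg (x : hull) : Prop := nneg (repr x).1.

Lemma hfrac_repr g n :
  (repr (hfrac g n)).1 *+ n.+1 = g *+ (repr (hfrac g n)).2.+1.
Proof.
by apply/hfrac_eq; rewrite -[RHS]reprK; case: (repr (hfrac g n)).
Qed.

Lemma hfracD g h n : hull_add (hfrac g n) (hfrac h n) = hfrac (g + h) n.
Proof.
apply/hfrac_eq; rewrite prednK //.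
have := hfrac_repr g n; have := hfrac_repr h n.
case: (repr _) => h' k; case: (repr _) => g' m /= hE gE.
rewrite !mulrnDl -!mulrnA (mulnC k.+1 n.+1) (mulnC m.+1 n.+1).
by rewrite !mulrnA gE hE -!mulrnA (mulnC k.+1).
Qed.

Lemma hfracN g n : hull_opp (hfrac g n) = hfrac (- g) n.
Proof. by apply/hfrac_eq; rewrite !mulNrn hfrac_repr. Qed.

Lemma hfrac_nneg g n : hull_nneg (hfrac g n) <-> nneg g.
Proof.
rewrite /hull_nneg; have := hfrac_repr g n; case: (repr _) => h m /= hE.
split=> [h0|g0].
  by apply: (@nneg_mulrSn _ _ m); rewrite -hE; exact: nnegMn.
by apply: (@nneg_mulrSn _ _ n); rewrite hE; exact: nnegMn.
Qed.

Lemma hull_addA : associative hull_add.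
Proof. by apply: hfracW3 => g h k n; rewrite !hfracD addrA. Qed.

Lemma hull_addC : commutative hull_add.
Proof. by apply: hfracW2 => g h n; rewrite !hfracD addrC. Qed.

Lemma hfrac0 n : hfrac 0 n = hfrac 0 0%N.
Proof. by apply/hfrac_eq; rewrite !mul0rn. Qed.

Lemma hull_add0 : left_id (hfrac 0 0%N) hull_add.
Proof. by elim/hfracW => g n; rewrite -(hfrac0 n) hfracD add0r. Qed.

Lemma hull_addN : left_inverse (hfrac 0 0%N) hull_opp hull_add.
Proof. by elim/hfracW => g n; rewrite hfracN hfracD addNr hfrac0. Qed.

HB.instance Definition _ :=
  GRing.isZmodule.Build hull hull_addA hull_addC hull_add0 hull_addN.

Lemma hull_nnegD (x y : hull) :
  hull_nneg x -> hull_nneg y -> hull_nneg (x + y).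
Proof.
move: x y; apply: hfracW2 => g h n.
rewrite [_ + _]hfracD => /hfrac_nneg g0 /hfrac_nneg h0.
by apply/hfrac_nneg; exact: nnegD.
Qed.

Lemma hull_nneg_anti (x : hull) : hull_nneg x -> hull_nneg (- x) -> x = 0.
Proof.
elim/hfracW: x => g n; rewrite [- _]hfracN => /hfrac_nneg g0 /hfrac_nneg Ng0.
by rewrite (nneg_anti g g0 Ng0) hfrac0.
Qed.

Lemma hull_nneg_total (x : hull) : hull_nneg x \/ hull_nneg (- x).
Proof.
elim/hfracW: x => g n; rewrite [- _]hfracN.
by have [g0|Ng0] := nneg_total g; [left|right]; apply/hfrac_nneg.
Qed.

HB.instance Definition _ := Zmodule_isTotallyOrdered.Build hull
  hull_nnegD hull_nneg_anti hull_nneg_total.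

Lemma hfracMn g n k : hfrac g n *+ k = hfrac (g *+ k) n.
Proof.
elim: k => [|k IHk]; first by rewrite !mulr0n hfrac0.
by rewrite !mulrS IHk [LHS]hfracD.
Qed.

Lemma hull_divisible (x : hull) n : exists y, y *+ n.+1 = x.
Proof.
elim/hfracW: x => g m; exists (hfrac g (m.+1 * n.+1).-1).
by rewrite hfracMn hfrac_mul.
Qed.

Definition hull_inj g : hull := hfrac g 0%N.

Lemma hull_injD : {morph hull_inj : g h / g + h}.
Proof. by move=> g h; rewrite /hull_inj -hfracD. Qed.

Lemma hull_inj_nneg g : nneg g -> nneg (hull_inj g).
Proof. by move=> g0; apply/hfrac_nneg. Qed.

Lemma hull_inj_inj : injective hull_inj.
Proof. by move=> g h /hfrac_eq; rewrite !mulr1n. Qed.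

End DivisibleHull.

(** * Unit intervals of ordered groups *)

Section Gamma.
Variables (G : oZmodType) (u : G).
Hypothesis u_nneg : nneg u.
Implicit Types x y z : G.

(** The minimum of [x] and [u]. *)
Definition trunc x : G := if `[< nneg (u - x) >] then x else u.

Lemma trunc_le x : nneg (u - x) -> trunc x = x.
Proof. by rewrite /trunc; case: asboolP. Qed.

Lemma trunc_ge x : nneg (x - u) -> trunc x = u.
Proof.
rewrite /trunc; case: asboolP => // ux xu.
by apply/eqP; rewrite -subr_eq0; apply/eqP/nneg_anti; rewrite ?opprB.
Qed.

Lemma truncP x :
  nneg (u - x) /\ trunc x = x \/ nneg (x - u) /\ trunc x = u.
Proof.
have [ux|xu] := nneg_subr_total x u; first by left; split=> //; exact: trunc_le.
by right; split=> //; exact: trunc_ge.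
Qed.

Lemma truncDl x y : nneg y -> trunc (trunc x + y) = trunc (x + y).
Proof.
move=> y0; have [[_ ->//]|[xu ->]] := truncP x.
rewrite !trunc_ge //; first by rewrite addrAC; exact: nnegD.
by rewrite addrAC subrr add0r.
Qed.

Definition in_unit_interval : pred G :=
  fun x => `[< nneg x /\ nneg (u - x) >].

(** The MV-algebra that Mundici's functor Gamma assigns to [G] and [u]. *)
Definition gamma_algebra of nneg u : Type := {x : G | in_unit_interval x}.

Local Notation gamma := (gamma_algebra u_nneg).

HB.instance Definition _ := Choice.on gamma.

Implicit Types a b c : gamma.

Definition gamma_mk x (x0 : nneg x) (ux : nneg (u - x)) : gamma :=
  exist _ x (asboolT (conj x0 ux)).

Lemma gamma_nneg a : nneg (sval a).
Proof. by case: a => x /= /asboolP[]. Qed.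

Lemma gamma_le a : nneg (u - sval a).
Proof. by case: a => x /= /asboolP[]. Qed.

Lemma gamma_eq a b : sval a = sval b -> a = b.
Proof. exact: val_inj. Qed.

Lemma trunc_nneg x : nneg x -> nneg (trunc x).
Proof. by rewrite /trunc; case: ifP. Qed.

Lemma trunc_bound x : nneg (u - trunc x).
Proof.
by rewrite /trunc; case: asboolP => // _; rewrite subrr; exact: nneg0.
Qed.

Lemma subu_bound x : nneg x -> nneg (u - (u - x)).
Proof. by rewrite opprB addrC subrK. Qed.

Definition gamma_zero : gamma :=
  gamma_mk (nneg0 G) (eq_ind_r nneg u_nneg (subr0 u)).
Definition gamma_add a b : gamma :=
  gamma_mk (trunc_nneg (nnegD _ _ (gamma_nneg a) (gamma_nneg b)))
    (trunc_bound _).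
Definition gamma_neg a : gamma :=
  gamma_mk (gamma_le a) (subu_bound (gamma_nneg a)).

Lemma gamma_addC : commutative gamma_add.
Proof. by move=> a b; apply: gamma_eq; rewrite /= addrC. Qed.

Lemma gamma_addA : associative gamma_add.
Proof.
move=> a b c; apply: gamma_eq; rewrite /= addrC.
by rewrite !truncDl; try exact: gamma_nneg; rewrite addrC addrA.
Qed.

Lemma gamma_add0 : left_id gamma_zero gamma_add.
Proof.
by move=> a; apply: gamma_eq; rewrite /= add0r trunc_le //; exact: gamma_le.
Qed.

HB.instance Definition _ :=
  GRing.isNmodule.Build gamma gamma_addA gamma_addC gamma_add0.

Lemma gamma_negK : involutive gamma_neg.
Proof. by move=> a; apply: gamma_eq; rewrite /= opprB addrC subrK. Qed.

Lemma gamma_addr1 a : gamma_add a (gamma_neg 0) = gamma_neg 0.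
Proof.
apply: gamma_eq => /=; rewrite subr0 trunc_ge // addrK; exact: gamma_nneg.
Qed.

(** Both sides of the axiom [mvjoinC] compute the maximum of [a] and [b], here [a]. *)
Lemma gamma_join a b : nneg (sval a - sval b) ->
  gamma_add (gamma_neg (gamma_add (gamma_neg a) b)) b = a /\
  gamma_add (gamma_neg (gamma_add (gamma_neg b) a)) a = a.
Proof.
move=> ba; split; apply: gamma_eq => /=.
  have E : u - (u - sval a + sval b) = sval a - sval b.
    by rewrite opprD opprB addrA [u + _]addrC subrK.
  rewrite (@trunc_le (u - sval a + sval b)) E // subrK trunc_le //.
  exact: gamma_le.
rewrite (@trunc_ge (u - sval b + sval a)); last first.
  by rewrite -[u - _ + _]addrA addrAC subrr add0r addrC.
by rewrite subrr add0r trunc_le //; exact: gamma_le.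
Qed.

Lemma gamma_joinC a b :
  gamma_add (gamma_neg (gamma_add (gamma_neg a) b)) b =
  gamma_add (gamma_neg (gamma_add (gamma_neg b) a)) a.
Proof.
by have [/gamma_join[-> ->]|/gamma_join[-> ->]] :=
  nneg_subr_total (sval a) (sval b).
Qed.

HB.instance Definition _ :=
  Nmodule_isMVAlgebra.Build gamma gamma_negK gamma_addr1 gamma_joinC.

Lemma gamma_valD a b : sval (a + b) = trunc (sval a + sval b).
Proof. by []. Qed.

Lemma gamma_valN a : sval (mvneg a) = u - sval a. Proof. by []. Qed.

Lemma gamma_val1 : sval (mvone : gamma) = u. Proof. exact: subr0. Qed.

Lemma gamma_valMn a n : sval (a *+ n) = trunc (sval a *+ n).
Proof.
elim: n => [|n IHn]; first by rewrite !mulr0n trunc_le // subr0.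
by rewrite !mulrSr gamma_valD IHn truncDl //; exact: gamma_nneg.
Qed.

End Gamma.

Definition mv_infinitesimal (A : mvAlgType) (x : A) : Prop :=
  forall n, mvle x (mvneg (x *+ n)).

Section GammaMaps.
Variables (G : oZmodType) (u : G).
Hypothesis u_nneg : nneg u.
Local Notation gammaG := (gamma_algebra u_nneg).

Lemma gamma_lift (C : mvAlgType) (f : C -> G) :
    f 0 = 0 -> (forall x, nneg (f x)) -> (forall x, f (mvneg x) = u - f x) ->
    (forall x y, f (x + y) = trunc u (f x + f y)) ->
  exists F : C -> gammaG, mv_morphism F /\ forall x, sval (F x) = f x.
Proof.
move=> f0 f_nneg fN fD.
have fle x : nneg (u - f x) by rewrite -fN.
exists (fun x => gamma_mk u_nneg (f_nneg x) (fle x)); split=> //.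
by split=> [|x y|x]; apply: gamma_eq => /=.
Qed.

Lemma gamma_sub_infinitesimal (a b : gammaG) :
  infinitesimal u (sval a - sval b) -> mv_infinitesimal (mvsub a b).
Proof.
move=> [bab _].
have bs : nbounded u (sval (mvsub a b)).
  rewrite /mvsub !(gamma_valN, gamma_valD).
  have [[_ ->]|[_ ->]] := truncP u (u - sval a + sval b).
    suff -> : u - (u - sval a + sval b) = sval a - sval b by [].
    by rewrite opprD opprB addrA [u + _]addrC subrK.
  by rewrite subrr; case: (infinitesimal0 u_nneg).
(* With [s] the value of [mvsub a b], the claim is [(u - s) + (u - n s) >= u], which is boundedness
   of [s] at [n + 1]. *)
move=> n; apply: gamma_eq.
rewrite gamma_val1 gamma_valD !gamma_valN gamma_valMn.
rewrite (trunc_le (bs n)) trunc_ge //.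
by rewrite -addrA [u - _ - u]addrAC subrr add0r -addrA -opprD -mulrS.
Qed.

Hypotheses (u_neq0 : u <> 0).
Hypothesis G_divisible : forall (x : G) n, exists y, y *+ n.+1 = x.

(** The group retraction fixes [u] and preserves the order, so it commutes with truncation. The last
    clause is the archimedean property that later makes kernels maximal. *)
Lemma gamma_infinitesimal_retraction : exists rho : gammaG -> gammaG,
  [/\ mv_morphism rho, forall x, mv_infinitesimal (mvsub x (rho x)),
      forall x, mv_infinitesimal (mvsub (rho x) x)
    & forall x, rho x <> 0 -> exists n, x *+ n = mvone].
Proof.
have [rho [rhoD rhou rho_nneg rho_inf rho_eq0]] :=
  infinitesimal_retraction u_nneg u_neq0 G_divisible.
have rho0 : rho 0 = 0 by apply: rho_eq0; exact: infinitesimal0.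
have rhoB x y : rho (x - y) = rho x - rho y.
  by apply/eqP; rewrite eq_sym subr_eq -rhoD subrK.
have [|x|x|x y|r [morr rE]] := @gamma_lift gammaG (rho \o sval).
- exact: rho0.
- by apply: rho_nneg; exact: gamma_nneg.
- by rewrite /= rhoB rhou.
- rewrite /= -rhoD; have [[ux ->]|[xu ->]] := truncP u (sval x + sval y).
    by move/rho_nneg: ux; rewrite rhoB rhou => /trunc_le->.
  by move/rho_nneg: xu; rewrite rhoB rhou => /trunc_ge->.
exists r; split=> // x.
- by apply: gamma_sub_infinitesimal; rewrite rE; exact: rho_inf.
- apply: gamma_sub_infinitesimal; rewrite rE -opprB.
  by apply: infinitesimalN; exact: rho_inf.
(* If no multiple of [x] is 1, truncation never acts, so all group multiples of [x] stay below [u]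
   and [rho] kills [x]. *)
- move=> rx0; apply: contrapT => /forallNP nx; apply: rx0; apply: gamma_eq.
  rewrite rE /=; apply: rho_eq0; split.
    move=> n; have [[//]|[_ E]] := truncP u (sval x *+ n).
    by case: (nx n); apply: gamma_eq; rewrite gamma_valMn E gamma_val1.
  by apply: (nbounded_nneg u_nneg); rewrite opprK; exact: gamma_nneg.
Qed.

End GammaMaps.

Lemma mv_chain_embedding (C : mvAlgType) :
    (forall x y : C, mvle x y \/ mvle y x) -> mvone != 0 :> C ->
  exists (D : mvAlgType) (e : C -> D) (rho : D -> D),
  [/\ mv_embedding e, mv_morphism rho,
      forall x, mv_infinitesimal (mvsub x (rho x)),
      forall x, mv_infinitesimal (mvsub (rho x) x)
    & forall x, rho x <> 0 -> exists n, x *+ n = mvone].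
Proof.
move=> C_total C_nontrivial.
pose G : oZmodType := hull (chang_group C_total C_nontrivial).
pose u : G := hull_inj (chang_unit C_total C_nontrivial).
have u_nneg : nneg u by exact: hull_inj_nneg.
pose f (a : C) : G := hull_inj (chang_inj C_total C_nontrivial a).
have f0 : f 0 = 0 by rewrite /f chang_inj0.
have fN a : f (mvneg a) = u - f a.
  by apply/eqP; rewrite eq_sym subr_eq -hull_injD chang_injN subrK.
have [a|//|a b|e [more eE]] := @gamma_lift G u u_nneg C f f0.
- by apply: hull_inj_nneg; exact: chang_inj_nneg.
- have hull_injB x y : hull_inj (x - y) = hull_inj x - hull_inj y :> G.
    by apply/eqP; rewrite eq_sym subr_eq -hull_injD subrK.
  have [[E le]|[E le]] := chang_injD C_total C_nontrivial a b.
    rewrite {1}/f E hull_injD trunc_le // -hull_injD -hull_injB.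
    exact: hull_inj_nneg.
  by rewrite {1}/f E trunc_ge // -hull_injD -hull_injB; exact: hull_inj_nneg.
have f_inj : injective f.
  by move=> a b /hull_inj_inj/chang_inj_inj.
have [|r [morr r1 r2 rT]] :=
  @gamma_infinitesimal_retraction G u u_nneg _ (@hull_divisible _).
  move=> u0; have /eqP := C_nontrivial; apply; apply: f_inj.
  by rewrite fN f0 subr0.
exists (gamma_algebra u_nneg), e, r; split=> //; split=> // a b eab.
by apply: f_inj; rewrite -!eE eab.
Qed.

(** * Products and the radical *)

Section Product.
Variables (I : Type) (T : I -> mvAlgType).

Definition mvprod : Type := forall i, T i.

HB.instance Definition _ := gen_eqMixin mvprod.
HB.instance Definition _ := gen_choiceMixin mvprod.

Implicit Types x y z : mvprod.

Definition mvprod_zero : mvprod := fun i => 0.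
Definition mvprod_add x y : mvprod := fun i => x i + y i.
Definition mvprod_neg x : mvprod := fun i => mvneg (x i).

Lemma mvprod_ext x y : (forall i, x i = y i) -> x = y.
Proof. exact: functional_extensionality_dep. Qed.

Lemma mvprod_addA : associative mvprod_add.
Proof. by move=> x y z; apply: mvprod_ext => i; exact: addrA. Qed.

Lemma mvprod_addC : commutative mvprod_add.
Proof. by move=> x y; apply: mvprod_ext => i; exact: addrC. Qed.

Lemma mvprod_add0 : left_id mvprod_zero mvprod_add.
Proof. by move=> x; apply: mvprod_ext => i; exact: add0r. Qed.

HB.instance Definition _ :=
  GRing.isNmodule.Build mvprod mvprod_addA mvprod_addC mvprod_add0.

Lemma mvprod_negK : involutive mvprod_neg.
Proof. by move=> x; apply: mvprod_ext => i; exact: mvnegK. Qed.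

Lemma mvprod_addr1 x : mvprod_add x (mvprod_neg 0) = mvprod_neg 0.
Proof. by apply: mvprod_ext => i; exact: mvaddr1. Qed.

Lemma mvprod_joinC x y :
  mvprod_add (mvprod_neg (mvprod_add (mvprod_neg x) y)) y =
  mvprod_add (mvprod_neg (mvprod_add (mvprod_neg y) x)) x.
Proof. by apply: mvprod_ext => i; exact: mvjoinC. Qed.

HB.instance Definition _ :=
  Nmodule_isMVAlgebra.Build mvprod mvprod_negK mvprod_addr1 mvprod_joinC.

Lemma mvprod_muln x n i : (x *+ n) i = x i *+ n.
Proof. by elim: n => [//|n IHn]; rewrite !mulrS -IHn. Qed.

Lemma mvprod_infinitesimal x :
  (forall i, mv_infinitesimal (x i)) -> mv_infinitesimal x.
Proof.
move=> ix n; apply: mvprod_ext => i.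
by have := ix i n; rewrite -mvprod_muln.
Qed.

End Product.

(** * Infinitesimals, maximal ideals and sections of the radical quotient *)

Section Radical.
Variable B : mvAlgType.
Implicit Types (x y : B) (M : set B).

(** If [x] is not in [M], then [1 = i + n x] for some [i] in [M], whence [x <= mvneg (n x) <= i]. *)
Lemma infinitesimal_maximal_ideal M x :
  mv_infinitesimal x -> mv_maximal_ideal M -> M x.
Proof.
move=> ix [idM _ maxM]; apply: contrapT => nMx.
have [i [n [Mi /mvsub_eq0]]] : mv_adjoin M x mvone.
  have [->//|/eqP nT] := eqVneq (mv_adjoin M x) setT.
  case: nMx; rewrite -(maxM _ (mv_adjoin_ideal x idM) _ nT).
    exact: mv_adjoin_mem.
  exact: mv_adjoin_sub.
rewrite /mvsub mvneg1 add0r => /(congr1 mvneg); rewrite mvnegK mvneg0 => in1.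
have [_ _ leM] := idM; apply: nMx; apply: leM Mi.
apply: mvle_trans (ix n) _; rewrite -[i]mvnegK; apply: mvleN.
by rewrite /mvle mvnegK.
Qed.

Lemma infinitesimal_Rad x : mv_infinitesimal x -> Rad B x.
Proof. by move=> ix M; exact: infinitesimal_maximal_ideal. Qed.

Lemma mv_morphism_kernel_ideal (D : mvAlgType) (h : B -> D) :
  mv_morphism h -> mv_ideal [set x | h x = 0].
Proof.
move=> [h0 hD hN]; split=> //= x y; first by rewrite hD => -> ->; rewrite addr0.
move=> /(congr1 h); rewrite /mvone hD !hN h0 => xy y0.
by apply: mvlex0; rewrite -y0.
Qed.

(** An ideal above the kernel with some [x] outside it contains [x *+ n], sent to 1, and also
    [mvneg (x *+ n)], sent to 0; their sum is 1. *)
Lemma mv_morphism_kernel_maximal (D : mvAlgType) (h : B -> D) :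
    mv_morphism h -> mvone <> 0 :> D ->
    (forall x, h x <> 0 -> exists n, h (x *+ n) = mvone) ->
  mv_maximal_ideal [set x | h x = 0].
Proof.
move=> morh D10 arch; have [h0 _ hN] := morh; split.
- exact: mv_morphism_kernel_ideal.
- by move/seteqP => [_ /(_ mvone I)] /=; rewrite /mvone hN h0.
move=> J idJ KJ JT; apply/seteqP; split=> // x Jx; apply: contrapT.
move=> /arch[n hxn].
have [_ JD leJ] := idJ; apply: JT; apply/seteqP; split=> // y _.
apply: (leJ _ mvone); first exact: mvlex1.
rewrite -(mvaddNx (x *+ n)); apply: JD; last exact: mv_ideal_muln.
by apply: KJ; rewrite /= hN hxn mvneg1.
Qed.

(** Since [rho] kills [Rad B], it is constant on the classes; since it moves elements only within
    their class, the induced map is a section. *)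
Lemma retractive_radical_of_endomorphism (rho : B -> B) :
    mv_morphism rho -> (forall x, Rad B (mvdist x (rho x))) ->
    (forall x, Rad B x -> rho x = 0) ->
  mv_retractive_radical B.
Proof.
move=> [rho0 rhoD rhoN] rhoR rho_eq0.
have rho_pi x y : \pi_(mvquot (Rad B)) x = \pi y -> rho x = rho y.
  move=> /mvquot_eqP/rho_eq0; rewrite /mvdist /mvsub rhoD !rhoN !rhoD !rhoN.
  exact: mvdist_eq0.
have [pi0 piD piN] := mvquot_pi_morphism (Rad B).
have rhoK (v : mvquot (Rad B)) : \pi_(mvquot (Rad B)) (rho (repr v)) = v.
  by rewrite -[RHS]reprK; apply/esym/mvquot_eqP; exact: rhoR.
exists (rho \o repr); split; last by apply/funext => v; exact: rhoK.
split; last by move=> v w /= vw; rewrite -(rhoK v) vw rhoK.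
split=> [|v w|v] /=.
- by rewrite -rho0; apply: rho_pi; rewrite reprK.
- by rewrite -rhoD; apply: rho_pi; rewrite reprK piD !reprK.
- by rewrite -rhoN; apply: rho_pi; rewrite reprK piN !reprK.
Qed.

End Radical.

Lemma mv_embedding_isomorphic (A B : mvAlgType) (f : A -> B) :
  mv_embedding f -> mv_isomorphic_to_subalgebra A B.
Proof.
move=> [[f0 fD fN] f_inj]; exists (range f); split.
  split=> [|_ _ [x _ <-] [y _ <-]|_ [x _ <-]]; first by exists 0.
    by exists (x + y).
  by exists (mvneg x).
exists f; split=> //; split=> [x _|x y _ _|//]; [by exists x|exact: f_inj].
Qed.

Theorem corollary7p6 (A : mvAlgType) :
  exists B : mvAlgType,
    mv_isomorphic_to_subalgebra A B /\ mv_retractive_radical B.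
Proof.
pose idx := {P : mvIdeal A | mv_prime_ideal P}.
pose pi (P : idx) (x : A) : mvquot (sval P) := \pi x.
have piE (P : idx) x y : pi P x = pi P y <-> sval P (mvdist x y).
  exact: mvquot_eqP.
have nontrivial (P : idx) : mvone != 0 :> mvquot (sval P).
  apply/eqP => P1; have [_ nP1 _] := svalP P; apply: nP1.
  have [pi0 _ piN] := mvquot_pi_morphism (sval P).
  have : pi P mvone = pi P 0 by rewrite /pi piN pi0.
  move/piE; rewrite /mvdist /mvsub mvneg1 mvaddx1 mvneg1 addr0.
  by rewrite add0r mvneg0.
have chainP (P : idx) := mv_chain_embedding
  (fun u v => mvquot_prime_total u v (svalP P)) (nontrivial P).
pose D (P : idx) : mvAlgType := projT1 (cid (chainP P)).
have ex_er (P : idx) :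
    exists er : (mvquot (sval P) -> D P) * (D P -> D P),
    [/\ mv_embedding er.1, mv_morphism er.2,
        forall x, mv_infinitesimal (mvsub x (er.2 x)),
        forall x, mv_infinitesimal (mvsub (er.2 x) x)
      & forall x, er.2 x <> 0 -> exists n, x *+ n = mvone].
  by rewrite /D; case: cid => /= E [e [rho H]]; exists (e, rho).
pose e P := (projT1 (cid (ex_er P))).1.
pose rho P := (projT1 (cid (ex_er P))).2.
have erP P : [/\ mv_embedding (e P), mv_morphism (rho P),
    forall x, mv_infinitesimal (mvsub x (rho P x)),
    forall x, mv_infinitesimal (mvsub (rho P x) x)
  & forall x, rho P x <> 0 -> exists n, x *+ n = mvone].
  by rewrite /e /rho; case: cid.
exists (mvprod D); split.
  apply: (@mv_embedding_isomorphic A (mvprod D) (fun x P => e P (pi P x))).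
  split.
    split=> [|x y|x]; apply: mvprod_ext => P;
      have [[[e0 eD eN] _] _ _ _ _] := erP P;
      have [pi0 piD piN] := mvquot_pi_morphism (sval P).
    - by rewrite /pi pi0 e0.
    - by rewrite /pi piD eD.
    - by rewrite /pi piN eN.
  (* If [x] and [y] differ, some prime ideal omits their distance, and they differ in that
     coordinate. *)
  move=> x y xy; apply: mvdist_eq0; apply: contrapT => d0.
  have [Q [prQ nQ]] := mv_prime_ideal_avoiding d0.
  have [idQ _ _] := prQ.
  pose P : idx := exist _ (MVIdeal idQ) prQ.
  have [[_ e_inj] _ _ _ _] := erP P.
  by apply/nQ/(piE P)/e_inj; exact: (congr1 (fun f => f P) xy).
have pr_morphism P : mv_morphism (fun x : mvprod D => rho P (x P)).
  have [_ [r0 rD rN] _ _ _] := erP P.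
  by split=> [|x y|x]; [exact: r0|exact: rD|exact: rN].
apply: (@retractive_radical_of_endomorphism (mvprod D)
  (fun (x : mvprod D) P => rho P (x P))).
- by split=> [|x y|x]; apply: mvprod_ext => P;
    have [r0 rD rN] := pr_morphism P; [exact: r0|exact: rD|exact: rN].
- move=> x; apply: mvidealD; apply: infinitesimal_Rad;
    apply: mvprod_infinitesimal => P; have [_ _ subr rsub _] := erP P.
    exact: subr.
  exact: rsub.
- move=> x Rx; apply: mvprod_ext => P.
  have [_ [r0 rD rN] _ _ rT] := erP P.
  (* In a one-element factor the kernel is not proper, but there the claim is trivial. *)
  have [D1|D1] := eqVneq (mvone : D P) 0.
    by apply: mvlex0; rewrite -D1; exact: mvlex1.
  have r1 : rho P mvone = mvone by rewrite /mvone rN r0.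
  (* The kernel of each coordinate of the endomorphism is a maximal ideal, so it contains [x]. *)
  apply: (Rx [set y | rho P (y P) = 0]).
  apply: mv_morphism_kernel_maximal (pr_morphism P) _ _; first exact/eqP.
  by move=> y /rT[n yn]; exists n; rewrite mvprod_muln yn.
Qed.
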